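(* Let $a_0>0$ and $\tau_2>0$ be fixed, and for $\sigma\in(0,1)$ put $a_\sigma=a_0|\log\sigma|^{1/\tau_2}$. For any $A_0>0$, for all sufficiently small $\sigma>0$ and every probability density $f$ compactly supported on $[-a_\sigma,a_\sigma]$, there exists an infinitely smooth probability density $f_{m_\sigma}$ on $[-a_\sigma,a_\sigma]$ such that $$\|\phi_\sigma*f-\phi_\sigma*f_{m_\sigma}\|_\infty\le\sigma^{-1}\exp\big(-A_0|\log\sigma|^{1/\tau_2}\big).$$
   Context: $\phi_\sigma(x)=\frac{1}{\sigma\sqrt{2\pi}}e^{-x^2/(2\sigma^2)}$, $*$ denotes convolution on $\mathbb{R}$ (densities on $[-a_\sigma,a_\sigma]$ are extended by $0$ outside), and $\|\cdot\|_\infty$ is the supremum norm. ''Infinitely smooth density on $[-a_\sigma,a_\sigma]$'' means a density supported on $[-a_\sigma,a_\sigma]$ that is infinitely differentiable on that interval. *)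

(* Defs.v *)
From mathcomp Require Import all_boot all_order all_algebra.
From mathcomp Require Import all_classical all_reals all_analysis.

Set Implicit Arguments.
Unset Strict Implicit.
Unset Printing Implicit Defensive.

Import Order.TTheory GRing.Theory Num.Theory.
Import numFieldNormedType.Exports.

Local Open Scope classical_set_scope.
Local Open Scope ring_scope.

Definition gaussian_kernel (R : realType) (sigma : R) : R -> R :=
  normal_pdf 0 sigma.

Lemma gaussian_kernelE (R : realType) (sigma x : R) : 0 < sigma ->
  gaussian_kernel sigma x =
  (sigma * Num.sqrt (2 * pi))^-1 * expR (- (x ^+ 2 / (2 * sigma ^+ 2))).
Proof.
move=> s0; rewrite /gaussian_kernel normal_pdfE ?gt_eqF//.
rewrite /normal_peak /normal_fun subr0 mulNr.
by rewrite !mulr_natl -mulrnAr sqrtrM ?sqr_ge0// sqrtr_sqr gtr0_norm.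
Qed.

Definition convolution (R : realType) (g f : R -> R) (x : R) : R :=
  (\int[@lebesgue_measure R]_y (g (x - y) * f y))%R.

(* The genuine supremum, not the essential one ['N[mu]_+oo]. *)
Definition sup_norm (R : realType) (h : R -> R) : \bar R :=
  ereal_sup (range (fun x => `|h x|%:E)).

Definition density_on (R : realType) (A : set R) (f : R -> R) : Prop :=
  [/\ measurable_fun setT f,
      forall x, 0 <= f x,
      (\int[@lebesgue_measure R]_x (f x)%:E = 1)%E &
      forall x, ~ A x -> f x = 0].

(* Differentiation relative to a set [A]: the variable [y] stays in [A], so
   that the derivatives are one-sided at the endpoints of a closed interval
   and a density extended by 0 may jump there. *)
Definition diff_quotient (R : realType) (f : R -> R) (x y : R) : R :=
  (f y - f x) / (y - x).

Definition derivable_within (R : realType) (A : set R) (f : R -> R) (x : R) :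
    Prop :=
  cvg (diff_quotient f x y @[y --> within A x^']).

Definition derive_within (R : realType) (A : set R) (f : R -> R) (x : R) : R :=
  lim (diff_quotient f x y @[y --> within A x^']).

Definition smooth_within (R : realType) (A : set R) (f : R -> R) : Prop :=
  forall (n : nat) (x : R), A x ->
    derivable_within A (iter n (derive_within A) f) x.

Definition half_width (R : realType) (a0 tau2 sigma : R) : R :=
  a0 * `|ln sigma| `^ tau2^-1.

(* Main.v *)
Require Import Defs.
From mathcomp Require Import all_boot all_order all_algebra.
From mathcomp Require Import all_classical all_reals all_analysis.
From mathcomp Require Import measurable_realfun ring lra.

Import Order.TTheory GRing.Theory Num.Theory.
Import numFieldNormedType.Exports.

Local Open Scope classical_set_scope.
Local Open Scope ring_scope.

(** For a fixed [sigma], the Gaussian kernel is bounded and uniformly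
    continuous, so any probability density [fm] that is weakly close to [f]
    has a convolution uniformly close to that of [f]; and densities that are
    polynomial on [[-a, a]] are weakly dense. The approximation is explicit:
    the Durrmeyer operator
      [M_n h (y) = int_a^b K_n(y, t) h(t) dt],
      [K_n(y, t) = (n + 1) / (b - a) * sum_k p_k(y) p_k(t)],
    where the [p_k] are the Bernstein polynomials of degree [n] on [[a, b]],
    turns an integrable function into a polynomial. Three facts about it carry
    the proof.

    - It is symmetric, because its kernel is: [int g * M_n f = int f * M_n g]
      ([pairing_durrmeyer]). Thus the effect on a convolution of replacing a
      merely integrable [f] by [M_n f] is the integral against [f] of the error
      [g - M_n g] made on the regular function [g(y) = phi_sigma(x - y)].
    - Its kernel is nonnegative with unit mass, so by the same symmetry [M_n]
      maps densities to densities ([durrmeyer_density]).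
    - The probability measure [K_n(y, t) dt] has second moment at most
      [(b - a)^2 / (n + 1)] about [y] ([durrmeyer_kernel_moment_le]): the Beta
      integrals give its moments as a mean over a binomial variable of a
      quadratic in that variable.

    Smallness of the second moment suffices as soon as [g] has a modulus of
    continuity [|g(u) - g(v)| <= e + D (u - v)^2], which holds for the Gaussian
    kernel with [e] arbitrarily small ([gaussian_modulus]). Taking [e] to be
    half of the tolerance and then [n] large bounds the difference of the
    convolutions uniformly in [x] ([convolution_durrmeyer]).

    Finally, a function that coincides with a polynomial on a nondegenerate
    interval is smooth relative to that interval: the difference quotients of
    a polynomial at [x] are the values of the exact quotient of [p - p(x)] by
    ['X - x] ([diff_quotient_poly_cvg]). *)

(** * Integration of polynomials against a function *)

Definition integrable_on {R : realType} (a b : R) (h : R -> R) :=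
  lebesgue_measure.-integrable `[a, b] (EFin \o h).

(** Polynomials enter as formal objects, so that linearity and the fundamental
    theorem of calculus reduce their integrals to identities in the ring of
    polynomials. *)
Definition pairing {R : realType} (a b : R) (h : R -> R) (p : {poly R}) : R :=
  \int[lebesgue_measure]_(t in `[a, b]) (h t * p.[t]).

Lemma integrable_onZ {R : realType} (a b c : R) (h : R -> R) :
  integrable_on a b h -> integrable_on a b (fun t => c * h t).
Proof. by move=> hi; have := integrableZl _ c hi; apply. Qed.

Lemma integrable_onB {R : realType} (a b : R) (g h : R -> R) :
  integrable_on a b g -> integrable_on a b h ->
  integrable_on a b (fun t => g t - h t).
Proof. by move=> gi hi; have := integrableB _ gi hi; apply. Qed.

Lemma integrableM_continuous {R : realType} (a b : R) (h g : R -> R) :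
  integrable_on a b h -> continuous g -> integrable_on a b (fun t => h t * g t).
Proof.
move=> hi gc.
suff gb : [bounded g t | t in `[a, b]].
  have := integrableMl _ hi _ gb; apply => //.
  by apply: measurable_funTS; exact: continuous_measurable_fun.
have /compact_bounded : compact (g @` `[a, b]).
  apply: continuous_compact; last exact: segment_compact.
  exact: continuous_subspaceT.
by move=> [M [Mr MP]]; exists M; split => // x Mx y yab;
  apply: (MP x Mx); exists y.
Qed.

Lemma integrableM_poly {R : realType} (a b : R) (h : R -> R) (p : {poly R}) :
  integrable_on a b h -> integrable_on a b (fun t => h t * p.[t]).
Proof.
by move=> hi; apply: integrableM_continuous => //; exact: continuous_horner.
Qed.

Lemma pairingD {R : realType} {a b : R} {h : R -> R} (p q : {poly R}) :
  integrable_on a b h ->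
  pairing a b h (p + q) = pairing a b h p + pairing a b h q.
Proof.
move=> hi; rewrite /pairing -RintegralD//; try exact: integrableM_poly.
by apply: eq_Rintegral => t _; rewrite hornerD mulrDr.
Qed.

Lemma pairingZ {R : realType} {a b : R} {h : R -> R} c (p : {poly R}) :
  integrable_on a b h -> pairing a b h (c *: p) = c * pairing a b h p.
Proof.
move=> hi; rewrite /pairing -RintegralZl//; try exact: integrableM_poly.
by apply: eq_Rintegral => t _; rewrite hornerZ mulrCA.
Qed.

Lemma pairing_sum {R : realType} {a b : R} {h : R -> R} {n : nat}
    (P : 'I_n -> {poly R}) :
  integrable_on a b h ->
  pairing a b h (\sum_(k < n) P k) = \sum_(k < n) pairing a b h (P k).
Proof.
move=> hi; elim/big_rec2: _ => [|i y1 y2 _ <-]; last by rewrite pairingD.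
by rewrite -(scale0r 0) pairingZ// mul0r.
Qed.

Lemma integrable_cst1 {R : realType} (a b : R) : integrable_on a b (cst 1).
Proof.
apply: continuous_compact_integrable; first exact: segment_compact.
by apply: continuous_subspaceT => x; exact: cvg_cst.
Qed.

Lemma pairing1_deriv {R : realType} {a b : R} (p : {poly R}) : a < b ->
  pairing a b (cst 1) p^`() = p.[b] - p.[a].
Proof.
move=> ab; rewrite /pairing /Rintegral.
under eq_integral do rewrite mul1r.
rewrite (@continuous_FTC2 _ _ (horner p))//.
- exact/continuous_subspaceT/continuous_horner.
- split => [x _||].
  + exact: derivable_horner.
  + exact/cvg_at_right_filter/continuous_horner.
  + exact/cvg_at_left_filter/continuous_horner.
- by move=> x _; rewrite derivE.
Qed.

(** * Beta integrals *)

Definition ucoord {R : realType} (a b : R) : {poly R} :=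
  (b - a)^-1 *: ('X - a%:P).

Lemma horner_ucoord {R : realType} (a b y : R) :
  (ucoord a b).[y] = (y - a) / (b - a).
Proof. by rewrite hornerZ hornerXsubC mulrC. Qed.

Lemma deriv_ucoord {R : realType} (a b : R) :
  (ucoord a b)^`() = ((b - a)^-1)%:P.
Proof. by rewrite derivZ derivXsubC alg_polyC. Qed.

Definition beta_poly {R : realType} (a b : R) (j l : nat) : {poly R} :=
  ucoord a b ^+ j * (1 - ucoord a b) ^+ l.

Lemma horner_beta_poly {R : realType} (a b y : R) j l :
  (beta_poly a b j l).[y] =
  ((y - a) / (b - a)) ^+ j * (1 - (y - a) / (b - a)) ^+ l.
Proof.
by rewrite /beta_poly hornerM !horner_exp hornerD hornerN hornerC horner_ucoord.
Qed.

(** The derivative of [U^(j+1) (1 - U)^(l+1)], where [U] is the affine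
    coordinate on [[a, b]], integrates to 0; rewriting one factor [1 - U] of it
    turns this into a recurrence in [j] alone. *)
Lemma beta_integralS {R : realType} {a b : R} (j l : nat) : a < b ->
  pairing a b (cst 1) (beta_poly a b j.+1 l) =
  j.+1%:R / (j + l).+2%:R * pairing a b (cst 1) (beta_poly a b j l).
Proof.
move=> ab; have i1 := integrable_cst1 a b.
have w0 : b - a != 0 by rewrite subr_eq0 gt_eqF.
have E : (beta_poly a b j.+1 l.+1)^`() =
  ((b - a)^-1 * j.+1%:R) *: beta_poly a b j l +
  (- ((b - a)^-1 * (j + l).+2%:R)) *: beta_poly a b j.+1 l.
  rewrite /beta_poly derivM !deriv_exp -!(mulr_natr (_ * _ ^+ _)).
  rewrite derivD derivN derivC deriv_ucoord /=.
  rewrite -!mul_polyC !polyCN !polyCM !polyC_natr.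
  rewrite (_ : (j + l).+2 = j.+1 + l.+1)%N; last by rewrite addnS.
  rewrite natrD; move: (ucoord a b) => U; rewrite !exprS. ring.
have := pairing1_deriv (beta_poly a b j.+1 l.+1) ab.
rewrite E (pairingD _ _ i1) !(pairingZ _ _ i1) !horner_beta_poly subrr mul0r.
rewrite divff// subrr.
rewrite !exprS !mul0r mulr0 subr0.
have : (j + l).+2%:R != 0 :> R by rewrite pnatr_eq0.
move: (j + l).+2%:R (b - a) w0 => c w w0 jl H.
apply: (mulfI (mulf_neq0 (invr_neq0 w0) jl)).
apply: subr0_eq; rewrite -oppr0 -H; field.
by rewrite jl w0.
Qed.

Lemma beta_integral0 {R : realType} (a b : R) (l : nat) : a < b ->
  pairing a b (cst 1) (beta_poly a b 0 l) = (b - a) / l.+1%:R.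
Proof.
move=> ab; have i1 := integrable_cst1 a b.
have w0 : b - a != 0 by rewrite subr_eq0 gt_eqF.
have E : (beta_poly a b 0 l.+1)^`() =
    (- ((b - a)^-1 * l.+1%:R)) *: beta_poly a b 0 l.
  rewrite /beta_poly !expr0 !mul1r !deriv_exp -!(mulr_natr (_ * _ ^+ _)).
  rewrite derivD derivN derivC deriv_ucoord /=.
  rewrite -!mul_polyC !polyCN !polyCM !polyC_natr.
  ring.
have := pairing1_deriv (beta_poly a b 0 l.+1) ab.
rewrite E !(pairingZ _ _ i1) !horner_beta_poly subrr mul0r divff// subrr.
rewrite !expr0 !mul1r !exprS !mul0r subr0 expr1n mulr1.
have : l.+1%:R != 0 :> R by rewrite pnatr_eq0.
move: l.+1%:R (b - a) w0 => c w w0 jl H.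
apply: (mulfI (mulf_neq0 (invr_neq0 w0) jl)).
rewrite -[LHS]opprK -mulNr H; field.
by rewrite jl w0.
Qed.

Lemma beta_integral {R : realType} {a b : R} (j l : nat) : a < b ->
  'C(j + l, j)%:R * pairing a b (cst 1) (beta_poly a b j l) =
  (b - a) / (j + l).+1%:R.
Proof.
move=> ab; elim: j => [|j IH]; first by rewrite bin0 mul1r beta_integral0.
rewrite beta_integralS// addSn.
have d : j.+1%:R * 'C((j + l).+1, j.+1)%:R =
    (j + l).+1%:R * 'C(j + l, j)%:R :> R.
  by rewrite -!natrM mul_bin_diag.
have n0 k : k.+1%:R != 0 :> R by rewrite pnatr_eq0.
rewrite !mulrA [in LHS](mulrC 'C(_, _)%:R) d.
rewrite [LHS](_ : _ = (j + l).+1%:R / (j + l).+2%:R *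
  ('C(j + l, j)%:R * pairing a b (cst 1) (beta_poly a b j l))); last by ring.
rewrite IH.
move: (j + l).+1%:R (j + l).+2%:R (n0 (j + l)%N) (n0 (j + l).+1) => c e c0 e0.
by field; rewrite c0 e0.
Qed.

(** * Moments of the binomial distribution *)

Definition binomial_mean {R : realType} (n : nat) (u : R) (g : nat -> R) : R :=
  \sum_(k < n.+1) 'C(n, k)%:R * (u ^+ k * (1 - u) ^+ (n - k)) * g k.

(** Conditioning on the last of [n + 1] Bernoulli trials. *)
Lemma binomial_meanS {R : realType} n (u : R) g :
  binomial_mean n.+1 u g =
  (1 - u) * binomial_mean n u g + u * binomial_mean n u (g \o S).
Proof.
rewrite /binomial_mean big_ord_recl /= !mulr_sumr.
rewrite [in X in _ = X + _]big_ord_recl /= !bin0 !subn0 !expr0 !mul1r.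
under eq_bigr => i _ do rewrite /bump /= !add1n binS natrD subSS !mulrDl.
rewrite big_split /= addrA; congr (_ + _); last first.
  by apply: eq_bigr => i _; rewrite exprS; ring.
congr (_ + _).
  by rewrite exprS; ring.
rewrite big_ord_recr /= bin_small// !mul0r addr0.
apply: eq_bigr => i _; rewrite /bump /= !add1n.
by rewrite -(subnSK (ltn_ord i)) (exprS (1 - u)); ring.
Qed.

Lemma eq_binomial_mean {R : realType} n (u : R) g h : g =1 h ->
  binomial_mean n u g = binomial_mean n u h.
Proof. by move=> gh; apply: eq_bigr => i _; rewrite gh. Qed.

Lemma binomial_mean_quadratic {R : realType} n (u c0 c1 c2 : R) :
  binomial_mean n u (fun k => c0 + c1 * k%:R + c2 * k%:R ^+ 2) =
  c0 + c1 * (n%:R * u) + c2 * (n%:R * u * (1 - u) + (n%:R * u) ^+ 2).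
Proof.
elim: n c0 c1 c2 => [|n IH] c0 c1 c2.
  by rewrite /binomial_mean big_ord1 bin0 subnn !expr0 /=; ring.
rewrite binomial_meanS IH.
rewrite (@eq_binomial_mean _ _ _ _ (fun k =>
  (c0 + c1 + c2) + (c1 + 2 * c2) * k%:R + c2 * k%:R ^+ 2)).
  by rewrite IH -natr1; ring.
by move=> k /=; rewrite -natr1; ring.
Qed.

(** * The Durrmeyer operator *)

Definition bernstein {R : realType} (a b : R) (n k : nat) : {poly R} :=
  'C(n, k)%:R *: beta_poly a b k (n - k).

(** Written as a combination of Bernstein polynomials rather than as the
    integral of a kernel, so that it is a polynomial by construction. *)
Definition durrmeyer {R : realType} (a b : R) (n : nat) (h : R -> R) :
    {poly R} :=
  (n.+1%:R / (b - a)) *: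
    \sum_(k < n.+1) pairing a b h (bernstein a b n k) *: bernstein a b n k.

Definition durrmeyer_kernel {R : realType} (a b : R) (n : nat) (y : R) :
    {poly R} :=
  (n.+1%:R / (b - a)) *:
    \sum_(k < n.+1) (bernstein a b n k).[y] *: bernstein a b n k.

Lemma bernstein_ge0 {R : realType} (a b : R) n k y :
  a < b -> a <= y <= b -> 0 <= (bernstein a b n k).[y].
Proof.
move=> ab /andP[ay yb]; have w0 : 0 < b - a by rewrite subr_gt0.
rewrite hornerZ horner_beta_poly mulr_ge0// mulr_ge0// exprn_ge0//.
  by rewrite divr_ge0 ?subr_ge0// ltW.
by rewrite subr_ge0 ler_pdivrMr// mul1r lerD2r.
Qed.

(** Both sides are the same symmetric bilinear form in the integrals of [g] and
    [h] against the Bernstein polynomials. *)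
Lemma pairing_durrmeyer {R : realType} (a b : R) n (g h : R -> R) :
  integrable_on a b g -> integrable_on a b h ->
  pairing a b g (durrmeyer a b n h) = pairing a b h (durrmeyer a b n g).
Proof.
move=> gi hi; rewrite /durrmeyer (pairingZ _ _ gi) (pairingZ _ _ hi).
rewrite (pairing_sum _ gi) (pairing_sum _ hi); apply: (congr1 ( *%R _)).
apply: eq_bigr => k _.
by rewrite [LHS](pairingZ _ _ gi) [RHS](pairingZ _ _ hi) mulrC.
Qed.

Lemma horner_durrmeyer {R : realType} (a b : R) n (h : R -> R) y :
  integrable_on a b h ->
  (durrmeyer a b n h).[y] = pairing a b h (durrmeyer_kernel a b n y).
Proof.
move=> hi; rewrite (pairingZ _ _ hi) (pairing_sum _ hi) hornerZ horner_sum.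
apply: (congr1 ( *%R _)); apply: eq_bigr => k _.
by rewrite hornerZ [RHS](pairingZ _ _ hi) mulrC.
Qed.

Lemma durrmeyer_kernel_ge0 {R : realType} (a b : R) n y t :
  a < b -> a <= y <= b -> a <= t <= b -> 0 <= (durrmeyer_kernel a b n y).[t].
Proof.
move=> ab yab tab; rewrite hornerZ mulr_ge0//.
  by rewrite divr_ge0// subr_ge0 ltW.
rewrite horner_sum sumr_ge0// => k _.
by rewrite hornerZ mulr_ge0// bernstein_ge0.
Qed.

Lemma durrmeyer_ge0 {R : realType} (a b : R) n (h : R -> R) t :
  a < b -> a <= t <= b -> (forall x, a <= x <= b -> 0 <= h x) ->
  0 <= (durrmeyer a b n h).[t].
Proof.
move=> ab tab h0; rewrite hornerZ mulr_ge0//.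
  by rewrite divr_ge0// subr_ge0 ltW.
rewrite horner_sum sumr_ge0// => k _.
rewrite hornerZ mulr_ge0// ?bernstein_ge0//.
apply: Rintegral_ge0 => x /=; rewrite in_itv /= => xab.
by rewrite mulr_ge0// ?h0// bernstein_ge0.
Qed.

(** With [u] the coordinate of [y], the Beta integrals express the moment of
    the [k]-th Bernstein polynomial as a quadratic [c0 + c1 k + c2 k^2], which
    the factor [p_k(y)] then averages under the binomial law. Carrying the
    weight [e + D ('X - y)^2] along yields the mass ([D = 0]) and the bound
    needed for a modulus of continuity in one computation. *)
Lemma durrmeyer_kernel_moment {R : realType} (a b y e D : R) n : a < b ->
  pairing a b (cst 1)
    (durrmeyer_kernel a b n y * (e%:P + D *: ('X - y%:P) ^+ 2)) =
  e + D * (b - a) ^+ 2 *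
    (2 * ((n%:R - 3) * ((y - a) / (b - a) * (1 - (y - a) / (b - a))) + 1) /
     (n.+2%:R * n.+3%:R)).
Proof.
move=> ab; have i1 := integrable_cst1 a b.
set u := (y - a) / (b - a).
have w0 : b - a != 0 by rewrite subr_eq0 gt_eqF.
have XE : 'X - y%:P = (b - a) *: (ucoord a b - u%:P).
  rewrite scalerBr scalerA divff// scale1r -mul_polyC -polyCM /u mulrC divfK//.
  by rewrite polyCB opprB addrA subrK.
rewrite -scalerAl (pairingZ _ _ i1) mulr_suml (pairing_sum _ i1).
pose c0 := e + D * (b - a) ^+ 2 *
  (2 / (n.+2%:R * n.+3%:R) - 2 * u / n.+2%:R + u ^+ 2).
pose c1 := D * (b - a) ^+ 2 *
  (3 / (n.+2%:R * n.+3%:R) - 2 * u / n.+2%:R).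
pose c2 := D * (b - a) ^+ 2 / (n.+2%:R * n.+3%:R).
have n0 k : k.+1%:R != 0 :> R by rewrite pnatr_eq0.
transitivity (binomial_mean n u (fun k => c0 + c1 * k%:R + c2 * k%:R ^+ 2)).
  rewrite /binomial_mean mulr_sumr; apply: eq_bigr => k _.
  have kn : (k <= n)%N by rewrite -ltnS.
  rewrite -[_ *: bernstein a b n k * _]scalerAl (pairingZ _ _ i1).
  rewrite hornerZ horner_beta_poly -/u.
  (* As ['X - y] is [(b - a) (U - u)], the weight is quadratic in [U]. *)
  have -> : bernstein a b n k * (e%:P + D *: ('X - y%:P) ^+ 2) =
    ((e + D * (b - a) ^+ 2 * u ^+ 2) * 'C(n, k)%:R) *: beta_poly a b k (n - k) +
    ((- 2 * u * (D * (b - a) ^+ 2) * 'C(n, k)%:R) *: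
       beta_poly a b k.+1 (n - k) +
     (D * (b - a) ^+ 2 * 'C(n, k)%:R) *: beta_poly a b k.+2 (n - k)).
    rewrite XE /bernstein /beta_poly.
    generalize (ucoord a b) (b - a) u => U w v.
    rewrite -!mul_polyC !(polyCD, polyCM, polyCN, polyC_exp, polyC_natr) !exprS.
    ring.
  rewrite !(pairingD _ _ i1) !(pairingZ _ _ i1) !(beta_integralS _ _ ab).
  rewrite addSn (subnKC kn).
  have := beta_integral k (n - k) ab; rewrite (subnKC kn) => B.
  set J := pairing a b _ _ in B *.
  have -> : J = (b - a) / n.+1%:R / 'C(n, k)%:R.
    by rewrite -B mulrAC divff ?mul1r// pnatr_eq0 -lt0n bin_gt0.
  have C0 : 'C(n, k)%:R != 0 :> R by rewrite pnatr_eq0 -lt0n bin_gt0.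
  rewrite /c0 /c1 /c2 -(@natr1 R k.+1) -(@natr1 R k).
  move: (n0 n) (n0 n.+1) (n0 n.+2) C0 w0.
  move: n.+1%:R n.+2%:R n.+3%:R 'C(n, k)%:R (b - a) (k%:R : R).
  move: (_ ^+ k * _ ^+ _).
  move=> q m1 m2 m3 C w kk m10 m20 m30 C0 w0.
  by field; rewrite m10 m20 m30 C0 w0.
rewrite binomial_mean_quadratic /c0 /c1 /c2.
have := n0 n.+1; have := n0 n.+2.
rewrite -(@natr1 R n.+2) -(@natr1 R n.+1) -(@natr1 R n).
move: (n%:R : R) => m m3 m2.
by field; rewrite m3 m2.
Qed.

Lemma durrmeyer_kernel_mass {R : realType} (a b y : R) n : a < b ->
  pairing a b (cst 1) (durrmeyer_kernel a b n y) = 1.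
Proof.
move=> ab; have := durrmeyer_kernel_moment a b y 1 0 n ab.
by rewrite scale0r addr0 mulr1 !mul0r addr0.
Qed.

(** With [u] the coordinate of [y], [u (1 - u) <= 1/4] bounds the numerator of
    the moment by [n / 2 + 2 <= n + 3], which cancels a factor of the
    denominator. *)
Lemma durrmeyer_kernel_moment_le {R : realType} (a b y e D : R) n :
  a < b -> a <= y <= b -> 0 <= D ->
  pairing a b (cst 1)
    (durrmeyer_kernel a b n y * (e%:P + D *: ('X - y%:P) ^+ 2)) <=
  e + D * (b - a) ^+ 2 / n.+1%:R.
Proof.
move=> ab /andP[ay yb] D0; rewrite durrmeyer_kernel_moment// lerD2l ler_wpM2l//.
  by rewrite mulr_ge0// sqr_ge0.
have w0 : 0 < b - a by rewrite subr_gt0.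
have u0 : 0 <= (y - a) / (b - a) by rewrite divr_ge0 ?subr_ge0// ltW.
have u1 : (y - a) / (b - a) <= 1 by rewrite ler_pdivrMr// mul1r lerD2r.
move: ((y - a) / (b - a)) u0 u1 => u u0 u1.
rewrite -(@natr1 R n.+2) -(@natr1 R n.+1) -(@natr1 R n).
have : 0 <= n%:R :> R by rewrite ler0n.
move: (n%:R : R) => m m0.
have m1 : 0 < m + 1 by lra.
rewrite ler_pdivrMr; last by nra.
rewrite [leRHS]mulrC ler_pdivlMr//.
have v0 : 0 <= u * (1 - u) by nra.
have v1 : u * (1 - u) <= 4^-1 by have := sqr_ge0 (u - 2^-1); nra.
move: (u * (1 - u)) v0 v1 => v v0 v1.
have mv : m * v <= m * 4^-1 by rewrite ler_wpM2l.
have : 2 * ((m - 3) * v + 1) <= m / 2 + 2 by lra.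
move: (2 * _) => z; nra.
Qed.

(** Since the kernel at [y] is a probability density, the error is the mean of
    [g y - g t] under it, and the modulus of continuity is affine in the second
    moment. *)
Lemma durrmeyer_error {R : realType} (a b : R) n (g : R -> R) (e D : R) y :
  a < b -> a <= y <= b -> 0 <= D -> integrable_on a b g ->
  (forall t, `|g y - g t| <= e + D * (t - y) ^+ 2) ->
  `|g y - (durrmeyer a b n g).[y]| <= e + D * (b - a) ^+ 2 / n.+1%:R.
Proof.
move=> ab yab D0 gi gD; have i1 := integrable_cst1 a b.
apply: le_trans (durrmeyer_kernel_moment_le a b y e D n ab yab D0).
rewrite (horner_durrmeyer _ _ _ _ _ gi).
have <- : g y * pairing a b (cst 1) (durrmeyer_kernel a b n y) = g y.
  by rewrite durrmeyer_kernel_mass// mulr1.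
have ki h : integrable_on a b h ->
    integrable_on a b (fun t => h t * (durrmeyer_kernel a b n y).[t]).
  exact: integrableM_poly.
rewrite /pairing -(RintegralZl _ _ (ki _ i1))//.
rewrite -(RintegralB _ _ (ki _ gi))//; last first.
  by apply: integrable_onZ; exact: ki.
have di : integrable_on a b (fun t =>
    g y * (cst 1 t * (durrmeyer_kernel a b n y).[t]) -
    g t * (durrmeyer_kernel a b n y).[t]).
  apply: integrable_onB; last exact: ki.
  by apply: integrable_onZ; exact: ki.
apply: le_trans (le_normr_Rintegral _ di) _ => //.
apply: le_Rintegral => //.
- by have := integrable_norm di; apply.
- exact: integrableM_poly.
move=> t /=; rewrite in_itv /= => tab.
have k0 := durrmeyer_kernel_ge0 a b n y t ab yab tab.
rewrite !mul1r -mulrBl normrM (ger0_norm k0) hornerM mulrC ler_wpM2l//.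
by rewrite hornerD hornerC hornerZ horner_exp hornerXsubC; exact: gD.
Qed.

(** * Smoothness of polynomials relative to an interval *)

(** Uniqueness of relative limits: every point of a nondegenerate interval is
    approached from within it, from the right or, at [b], from the left. *)
Lemma itv_punctured_proper {R : realType} (a b x : R) :
  a < b -> `[a, b]%classic x -> ProperFilter (within `[a, b]%classic x^').
Proof.
move=> ab; rewrite /= in_itv /= => /andP[ax xb].
apply: Build_ProperFilter; rewrite /within /= => H.
have [xlb|bx] := ltP x b.
  have Hr : \forall y \near x^'+, ~ `[a, b]%classic y.
    have W : x^'+ `=>` x^' by apply: within_subset => y /= xy; rewrite gt_eqF.
    exact: W H.
  have /filter_ex[y [[+ xy] yb]] : \forall y \near x^'+,
      (~ `[a, b]%classic y /\ x < y) /\ y < b.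
    by near=> y; do 2?split; near: y => //;
      [exact: nbhs_right_gt|exact: nbhs_right_lt].
  by apply; rewrite /= in_itv /= (ltW yb) (le_trans ax (ltW xy)).
have ax' : a < x by exact: lt_le_trans bx.
have Hl : \forall y \near x^'-, ~ `[a, b]%classic y.
  have W : x^'- `=>` x^' by apply: within_subset => y /= xy; rewrite lt_eqF.
  exact: W H.
have /filter_ex[y [[+ yx] ay]] : \forall y \near x^'-,
    (~ `[a, b]%classic y /\ y < x) /\ a < y.
  by near=> y; do 2?split; near: y => //;
    [exact: nbhs_left_lt|exact: nbhs_left_gt].
by apply; rewrite /= in_itv /= (ltW ay) (le_trans (ltW yx) xb).
Unshelve. all: by end_near. Qed.

(** Off [x], the difference quotient is the polynomial [(p - p(x)) / ('X - x)],
    whose value at [x] is the derivative by the product rule. *)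
Lemma diff_quotient_poly_cvg {R : realType} (A : set R) (f : R -> R)
    (p : {poly R}) x : {in A, f =1 horner p} -> A x ->
  diff_quotient f x y @[y --> within A x^'] --> p^`().[x].
Proof.
move=> fp Ax.
have [q pE] : exists q, p - p.[x]%:P = q * ('X - x%:P).
  by apply/factor_theorem; rewrite rootE !hornerE subrr.
have -> : p^`().[x] = q.[x].
  have := congr1 (fun r : {poly R} => r^`().[x]) pE.
  rewrite /= derivB derivC subr0 derivM derivXsubC => ->.
  by rewrite mulr1 hornerD hornerM hornerXsubC subrr mulr0 add0r.
have : horner q y @[y --> within A x^'] --> q.[x].
  apply: cvg_trans; last exact: continuous_horner.
  apply: cvg_app; apply: (@cvg_trans _ x^').
    exact: cvg_within.
  exact: cvg_within.
apply: cvg_trans; apply: near_eq_cvg.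
near=> y.
have Ay : A y by near: y; exact: withinT.
have yx : y - x != 0.
  rewrite subr_eq0; near: y.
  exact: (@cvg_within _ x^' _ A _ (nbhs_dnbhs_neq x)).
rewrite /diff_quotient !fp ?inE//.
have := congr1 (horner^~ y) pE.
rewrite /= hornerD hornerN hornerC hornerM hornerXsubC => ->.
by rewrite mulfK.
Unshelve. all: by end_near. Qed.

Lemma smooth_within_poly {R : realType} (a b : R) (f : R -> R) (p : {poly R}) :
  a < b -> {in `[a, b]%classic, f =1 horner p} -> smooth_within `[a, b] f.
Proof.
move=> ab fp.
have iterE n x : `[a, b]%classic x ->
    iter n (derive_within `[a, b]) f x = p^`(n).[x].
  elim: n x => [|n IH] x Ax; first by rewrite derivn0; exact/fp/mem_set.
  rewrite iterS /derive_within derivnS.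
  have pf := itv_punctured_proper a b x ab Ax.
  apply: cvg_lim => //.
  by apply: diff_quotient_poly_cvg => // y; rewrite inE => /IH.
move=> n x Ax; apply/cvg_ex; exists p^`(n)^`().[x].
by apply: diff_quotient_poly_cvg => // y; rewrite inE => /iterE.
Qed.

(** * Modulus of continuity of the Gaussian kernel *)

(** By convexity [exp(-p) - exp(-q) <= exp(-p) (q - p)]; with [p = c u^2] and
    [q = c v^2], [q - p] is at most [c (u - v)^2] plus the cross term
    [2 c |u| |u - v|], whose factor [|u|] is absorbed by
    [exp(-p) <= 1 / (1 + p)]. *)
Lemma expR_sqr_diff {R : realType} (c u v : R) : 0 <= c ->
  expR (- (c * u ^+ 2)) - expR (- (c * v ^+ 2)) <=
  (1 + c) * `|u - v| + c * (u - v) ^+ 2.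
Proof.
move=> c0; set p := c * u ^+ 2; set q := c * v ^+ 2.
have p0 : 0 <= p by rewrite mulr_ge0// sqr_ge0.
have E0 := expR_gt0 (- p).
have E1 : expR (- p) <= 1 by rewrite -expR0 ler_expR oppr_le0.
have E2 : expR (- p) * (1 + p) <= 1.
  by rewrite expRN mulrC ler_pdivrMr ?expR_gt0// mul1r; exact: expR_ge1Dx.
have E3 : expR (- p) * (1 + (p - q)) <= expR (- q).
  rewrite [in leRHS](_ : - q = - p + (p - q)); last by ring.
  by rewrite expRD ler_pM2l// expR_ge1Dx.
have E4 : expR (- p) - expR (- q) <= expR (- p) * (q - p) by nra.
apply: (le_trans E4).
have d0 := normr_ge0 (u - v).
have qp : q - p <= c * (u - v) ^+ 2 + 2 * c * (`|u| * `|u - v|).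
  rewrite -normrM.
  have := ler_norm (- (u * (u - v))); rewrite normrN => H.
  rewrite (_ : q - p = c * (u - v) ^+ 2 + 2 * c * (- (u * (u - v)))).
    by rewrite lerD2l ler_wpM2l// mulr_ge0.
  by rewrite /q /p; ring.
apply: (le_trans (ler_wpM2l (ltW E0) qp)).
have cu : 2 * c * `|u| <= (1 + c) * (1 + p).
  rewrite /p -(real_normK (num_real u)); have := normr_ge0 u.
  move: `|u| => w w0.
  have := mulr_ge0 c0 (sqr_ge0 (1 - w)); have := sqr_ge0 (c * w).
  nra.
have k1 : expR (- p) * (c * (u - v) ^+ 2) <= c * (u - v) ^+ 2.
  by rewrite ler_piMl// mulr_ge0// sqr_ge0.
have k2 : expR (- p) * (2 * c * `|u|) <= 1 + c.
  apply: (le_trans (ler_wpM2l (ltW E0) cu)).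
  by rewrite mulrCA ler_piMr// addr_ge0.
have k3 := ler_wpM2r d0 k2.
rewrite mulrDr addrC; apply: lerD => //.
by apply: le_trans k3; rewrite !mulrA.
Qed.

(** The linear term [L |u - v|] of the modulus is traded for
    [e + (L^2 / e) (u - v)^2] by the arithmetic-geometric mean inequality, as
    only second moments of the approximation kernel are controlled. *)
Lemma gaussian_modulus {R : realType} (s e : R) : 0 < s -> 0 < e ->
  exists2 D : R, 0 <= D & forall u v,
    `|gaussian_kernel s u - gaussian_kernel s v| <= e + D * (u - v) ^+ 2.
Proof.
move=> s0 e0.
pose K : R := (s * Num.sqrt (2 * pi))^-1; pose c : R := (2 * s ^+ 2)^-1.
have K0 : 0 <= K.
  by rewrite invr_ge0 mulr_ge0// ?ltW// sqrtr_ge0.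
have c0 : 0 <= c by rewrite invr_ge0 mulr_ge0// sqr_ge0.
pose L := K * (1 + c).
have D0 : 0 <= K * c + L ^+ 2 / e.
  by rewrite addr_ge0//; [exact: mulr_ge0|rewrite divr_ge0 ?sqr_ge0// ltW].
exists (K * c + L ^+ 2 / e) => //.
have H u v : gaussian_kernel s u - gaussian_kernel s v <=
    e + (K * c + L ^+ 2 / e) * (u - v) ^+ 2.
  rewrite !gaussian_kernelE// -mulrBr -/K.
  rewrite ![_ / (2 * _)]mulrC -/c.
  apply: le_trans (ler_wpM2l K0 (expR_sqr_diff c u v c0)) _.
  rewrite -(real_normK (num_real (u - v))).
  move: (`|u - v| : R) (normr_ge0 (u - v)) => d d0.
  rewrite [leLHS](_ : _ = L * d + K * c * d ^+ 2); last by rewrite /L; ring.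
  rewrite [leRHS](_ : _ = e + L ^+ 2 / e * d ^+ 2 + K * c * d ^+ 2); last ring.
  rewrite lerD2r -subr_ge0.
  have : 0 <= ((L * d - e / 2) ^+ 2 + 3 / 4 * e ^+ 2) / e.
    by rewrite divr_ge0 ?(ltW e0)// addr_ge0 ?sqr_ge0// mulr_ge0 ?sqr_ge0//.
  by congr (0 <= _); field; rewrite gt_eqF.
by move=> u v; rewrite ler_norml H andbT lerNl opprB -(sqrrN (u - v)) opprB H.
Qed.

(** * Durrmeyer approximation of densities *)

Lemma density_integrable {R : realType} (a b : R) (f : R -> R) :
  density_on `[a, b] f -> integrable_on a b f.
Proof.
move=> [mf f0 f1 _]; rewrite /integrable_on.
apply: (@integrableS _ _ _ _ setT) => //.
apply/integrableP; split; first exact/measurable_EFinP.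
under eq_integral do rewrite /= ger0_norm//.
by rewrite f1 ltry.
Qed.

Lemma integral_density {R : realType} (a b : R) (f : R -> R) :
  density_on `[a, b] f -> \int[lebesgue_measure]_(t in `[a, b]) f t = 1.
Proof.
move=> [mf f0 f1 fA]; rewrite Rintegral_mkcond.
rewrite (_ : f \_ `[a, b] = f); first by rewrite /Rintegral f1.
apply/funext => t; rewrite patchE; case: ifPn => // /negP tA.
by rewrite fA// => At; apply: tA; rewrite inE.
Qed.

Lemma convolution_restrict {R : realType} (a b : R) (g f : R -> R) x :
  (forall y, ~ `[a, b]%classic y -> f y = 0) ->
  convolution g f x =
  \int[lebesgue_measure]_(y in `[a, b]) (g (x - y) * f y).
Proof.
move=> fA; rewrite [RHS]Rintegral_mkcond; apply: eq_Rintegral => y _.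
rewrite patchE; case: ifPn => // /negP yA.
by rewrite fA ?mulr0// => Ay; apply: yA; rewrite inE.
Qed.

(** The total mass is preserved because the operator is symmetric and fixes
    the constant 1. *)
Lemma durrmeyer_density {R : realType} (a b : R) n (f : R -> R) : a < b ->
  density_on `[a, b] f ->
  density_on `[a, b] (horner (durrmeyer a b n f) \_ `[a, b]).
Proof.
move=> ab df; have fi := density_integrable _ _ _ df.
have i1 := integrable_cst1 a b.
have [mf f0 f1 fA] := df; split.
- have mp := measurable_poly (durrmeyer a b n f) (A := `[a, b]%classic).
  have [+ _] := measurable_restrictT (horner (durrmeyer a b n f))
    (measurable_itv `[a, b]).
  by apply.
- move=> x; rewrite patchE; case: ifPn => //; rewrite inE /= in_itv /= => xab.
  by apply: durrmeyer_ge0 => // y _; exact: f0.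
- transitivity (\int[lebesgue_measure]_(x in `[a, b])
      ((durrmeyer a b n f).[x])%:E)%E.
    by rewrite [RHS]integral_mkcond restrict_EFin.
  have pi := integrableM_poly _ _ _ (durrmeyer a b n f) i1.
  transitivity (pairing a b (cst 1) (durrmeyer a b n f))%:E.
    rewrite /pairing /Rintegral fineK; last exact: integrable_fin_num.
    by apply: eq_integral => t _; rewrite mul1r.
  rewrite (pairing_durrmeyer _ _ _ _ _ i1 fi).
  rewrite -[RHS](congr1 EFin (integral_density _ _ _ df)); congr EFin.
  apply: eq_Rintegral => t _.
  by rewrite (horner_durrmeyer _ _ _ _ _ i1) durrmeyer_kernel_mass// mulr1.
- by move=> x xA; rewrite patchE memNset.
Qed.

(** Symmetry moves the operator from [f], merely integrable, to
    [y |-> g (x - y)], whose modulus of continuity is the same for all [x]. *)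
Lemma convolution_durrmeyer {R : realType} (a b : R) n (f g : R -> R)
    (e D : R) x :
  a < b -> density_on `[a, b] f -> continuous g -> 0 <= D ->
  (forall u v, `|g u - g v| <= e + D * (u - v) ^+ 2) ->
  `|convolution g f x
    - convolution g (horner (durrmeyer a b n f) \_ `[a, b]) x|
  <= e + D * (b - a) ^+ 2 / n.+1%:R.
Proof.
move=> ab df gc D0 gD; have fi := density_integrable _ _ _ df.
have [mf f0 f1 fA] := df.
pose h y := g (x - y).
have hc : continuous h.
  move=> y; apply: continuous_comp; last exact: gc.
  by apply: cvgB; [exact: cvg_cst|exact: cvg_id].
have hi : integrable_on a b h.
  apply: continuous_compact_integrable; first exact: segment_compact.
  exact: continuous_subspaceT.
rewrite (convolution_restrict _ _ _ _ _ fA).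
rewrite (convolution_restrict a b); last by move=> y yA; rewrite patchE memNset.
under [X in X - _]eq_Rintegral do rewrite mulrC -/(h _).
rewrite [X in _ - X](_ : _ = pairing a b h (durrmeyer a b n f)); last first.
  by apply: eq_Rintegral => y yA; rewrite patchE yA.
rewrite (pairing_durrmeyer _ _ _ _ _ hi fi).
set E := e + _.
have err y : a <= y <= b -> `|h y - (durrmeyer a b n h).[y]| <= E.
  move=> yab; apply: durrmeyer_error => // t.
  by rewrite /h (le_trans (gD _ _))// opprD opprK addrACA subrr add0r addrC.
have hfi : integrable_on a b (fun y => f y * h y).
  exact: integrableM_continuous.
have pfi := integrableM_poly _ _ _ (durrmeyer a b n h) fi.
rewrite /pairing -(RintegralB _ hfi pfi)//.
apply: le_trans (le_normr_Rintegral _ (integrable_onB _ _ _ _ hfi pfi)) _ => //.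
rewrite -[leRHS]mulr1 -(integral_density _ _ _ df) -(RintegralZl _ _ fi)//.
apply: le_Rintegral => //.
- by have := integrable_norm (integrable_onB _ _ _ _ hfi pfi); apply.
- exact: integrable_onZ.
move=> y /=; rewrite in_itv /= => yab.
by rewrite -mulrBr normrM ger0_norm// mulrC ler_wpM2r// err.
Qed.

Theorem lemma6p2 (R : realType) (a0 tau2 : R) (a0_gt0 : 0 < a0)
    (tau2_gt0 : 0 < tau2) (A0 : R) (A0_gt0 : 0 < A0) :
  exists2 sigma0 : R, 0 < sigma0 <= 1 &
    forall sigma : R, 0 < sigma < sigma0 ->
    forall f : R -> R,
      density_on `[- half_width a0 tau2 sigma, half_width a0 tau2 sigma] f ->
      exists fm : R -> R,
        [/\ density_on `[- half_width a0 tau2 sigma, half_width a0 tau2 sigma] fm,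
            smooth_within `[- half_width a0 tau2 sigma, half_width a0 tau2 sigma] fm &
            (sup_norm (fun x => convolution (gaussian_kernel sigma) f x
                              - convolution (gaussian_kernel sigma) fm x)%R
             <= (sigma^-1 * expR (- (A0 * `|ln sigma| `^ tau2^-1)))%:E)%E].
Proof.
(* Below the threshold 1, [ln s] is nonzero and the interval nondegenerate. *)
exists 1; first by rewrite ltr01 lexx.
move=> s /andP[s0 s1] f.
set a := half_width a0 tau2 s => df.
have a_gt0 : 0 < a.
  by rewrite mulr_gt0// powR_gt0// normr_gt0 lt_eqF// ln_lt0// s0.
have ab : - a < a by lra.
set tol := s^-1 * _.
have tol0 : 0 < tol by rewrite mulr_gt0 ?invr_gt0// expR_gt0.
have e0 : 0 < tol / 2 by rewrite divr_gt0.
have [D D0 gD] := gaussian_modulus s (tol / 2) s0 e0.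
pose n := Num.truncn (D * (a - - a) ^+ 2 / (tol / 2)).
exists (horner (durrmeyer (- a) a n f) \_ `[- a, a]); split.
- exact: durrmeyer_density.
- apply: (smooth_within_poly _ _ _ (durrmeyer (- a) a n f)) => // y yA.
  by rewrite patchE yA.
- apply: ge_ereal_sup => _ [x _ <-]; rewrite lee_fin.
  apply: le_trans (convolution_durrmeyer _ _ n _ _ _ _ x ab df _ D0 gD) _.
    by apply: continuous_normal_pdf; rewrite gt_eqF.
  have : D * (a - - a) ^+ 2 / (tol / 2) < n.+1%:R by exact: truncnS_gt.
  rewrite ltr_pdivrMr// => H.
  have : D * (a - - a) ^+ 2 / n.+1%:R <= tol / 2.
    by rewrite ler_pdivrMr ?ltr0n// mulrC ltW// mulrC (lt_le_trans H)// mulrC.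
  by move: (_ / n.+1%:R) => z; lra.
Qed.
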